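(* For any integers $k\geq 2$ and $\ell\geq 3$, \[ \mathrm{sat}_k(n,\text{Berge-}K_\ell)\geq (1+o(1))\frac{\ell-2}{k-1}\,n \quad\text{as } n\to\infty. \]
   Context: A hypergraph $\mathcal{H}$ is a Berge-$F$ (for a graph $F$) if $F$ and $\mathcal{H}$ can be embedded on a common vertex set with a bijection $\phi:E(F)\to E(\mathcal{H})$ such that $e\subseteq\phi(e)$ for all $e\in E(F)$; a hypergraph contains a Berge-$F$ if some subset of its edges forms a Berge-$F$. A $k$-uniform hypergraph $\mathcal{H}$ is Berge-$F$-saturated if it contains no Berge-$F$ but $\mathcal{H}+e$ contains a Berge-$F$ for every $k$-set $e\subseteq V(\mathcal{H})$ with $e\notin E(\mathcal{H})$. $\mathrm{sat}_k(n,\text{Berge-}F)$ is the minimum number of edges in a Berge-$F$-saturated $k$-uniform hypergraph on $n$ vertices. $K_\ell$ is the complete graph on $\ell$ vertices. *)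

(* Defs.v *)
From mathcomp Require Import all_boot all_order all_algebra.
From mathcomp Require Import all_classical all_reals all_analysis.

Set Implicit Arguments.
Unset Strict Implicit.
Unset Printing Implicit Defensive.

(* A hypergraph on the vertex type V is its set of edges {set {set V}}. *)

Definition uniform (V : finType) (k : nat) (H : {set {set V}}) : Prop :=
  forall e : {set V}, e \in H -> #|e| = k.

Record graph := Graph {
  vertices : finType;
  edges : {set {set vertices}};
  edges_uniform : uniform 2 edges
}.

Lemma complete_uniform (l : nat) :
  uniform 2 [set e : {set 'I_l} | #|e| == 2]%SET.
Proof. by move=> e; rewrite inE => /eqP. Qed.

Definition complete (l : nat) : graph := Graph (@complete_uniform l).

(* W is the common vertex set on which F and H are embedded by f and g; the
   bijection from E(F) to E(H) is a function that is injective on [edges F]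
   and has image H. *)
Definition is_berge (F : graph) (V : finType) (H : {set {set V}}) : Prop :=
  exists (W : finType) (f : vertices F -> W) (g : V -> W)
         (phi : {set vertices F} -> {set V}),
    [/\ injective f, injective g,
        {in edges F &, injective phi},
        [set phi e | e in edges F]%SET = H
      & forall e, e \in edges F -> f @: e \subset g @: phi e].

Definition contains_berge (F : graph) (V : finType) (H : {set {set V}}) :
    Prop :=
  exists2 H' : {set {set V}}, H' \subset H & is_berge F H'.

Definition berge_saturated (k : nat) (F : graph) (V : finType)
    (H : {set {set V}}) : Prop :=
  [/\ uniform k H, ~ contains_berge F H
    & forall e : {set V}, #|e| = k -> e \notin H ->
        contains_berge F (e |: H)%SET].

(* The value 'C(n, k) of the empty minimum does not affect the nonempty ones,
   since a k-uniform hypergraph on n vertices has at most 'C(n, k) edges. *)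
Definition sat (k n : nat) (F : graph) : nat :=
  \big[minn/'C(n, k)]_(H : {set {set 'I_n}} | `[< berge_saturated k F H >])
     #|H|.

Lemma sat_le (k n : nat) (F : graph) (H : {set {set 'I_n}}) :
  berge_saturated k F H -> sat k n F <= #|H|.
Proof.
move=> satH; rewrite /sat -big_filter.
have : H \in [seq X <- index_enum {set {set 'I_n}} |
                `[< berge_saturated k F X >]].
  by rewrite mem_filter mem_index_enum andbT; apply/asboolP.
elim: [seq _ <- _ | _] => // X s IH; rewrite inE big_cons.
case/predU1P => [<-|/IH]; first exact: geq_minl.
by apply: leq_trans; exact: geq_minr.
Qed.

Lemma sat_attained (k n : nat) (F : graph) :
  (exists H : {set {set 'I_n}}, berge_saturated k F H) ->
  exists2 H : {set {set 'I_n}}, berge_saturated k F H & #|H| = sat k n F.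
Proof.
case=> H0 sat0.
pose P (H : {set {set 'I_n}}) := `[< berge_saturated k F H >].
have P0 : P H0 by apply/asboolP.
case: (arg_minnP (fun H : {set {set 'I_n}} => #|H|) P0) => H /asboolP satH minH.
exists H => //; apply/eqP; rewrite eqn_leq sat_le // andbT /sat.
have [unifH _ _] := satH.
apply: (big_ind (fun m => #|H| <= m)) => [|m p lem lep|X PX].
- rewrite -[X in 'C(X, k)]card_ord -cardsT -cards_draws subset_leq_card //.
  by apply/fintype.subsetP => e He; rewrite inE finset.subsetT /= (unifH _ He).
- by rewrite leq_min lem.
- exact: minH.
Qed.

Lemma berge_saturated_exists (k : nat) (F : graph) (V : finType) :
  edges F != finset.set0 -> exists H : {set {set V}}, berge_saturated k F H.
Proof.
move=> F0.
pose P (H : {set {set V}}) := `[< uniform k H /\ ~ contains_berge F H >].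
have P0 : P finset.set0.
  apply/asboolP; split=> [e|]; first by rewrite inE.
  case=> H'; rewrite finset.subset0 => /eqP -> [W [f [g [phi [_ _ _ /eqP]]]]].
  by rewrite imset_eq0 (negPf F0).
case: (arg_maxnP (fun H : {set {set V}} => #|H|) P0) => H /asboolP[uH nH] maxH.
exists H; split=> // e ek eH; apply: contrapT => ncon.
have /maxH : P (e |: H)%SET.
  apply/asboolP; split=> // e'; rewrite !inE => /orP[/eqP ->//|]; exact: uH.
by rewrite /= cardsU1 eH add1n ltnn.
Qed.

(* Main.v *)
(* Let H be saturated and fix a degree bound D.  If a k-set e is not an edge,
   then the Berge clique created by adding e uses e for a pair of its core
   vertices x, y in e; the l - 2 other core vertices are neighbours of x, so y
   lies in l - 2 edges meeting the neighbourhood of x, and vice versa: x and y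
   are linked.  Hence every k vertices that are pairwise not linked form an
   edge, so a maximal set S of pairwise unlinked vertices of degree at most D
   has size bounded in terms of k and D.  The closed neighbourhood Z of S is
   also bounded, and by maximality each vertex of degree at most D outside Z
   lies in l - 2 edges meeting Z.  Such edges have at most k - 1 vertices
   outside Z, and at most k|H|/(D+1) vertices have degree more than D, so
   (k-1)|H| >= (l-2)(n - |Z| - k|H|/(D+1)).  Let n, then D, tend to infinity. *)

Require Import Defs.
From mathcomp Require Import all_boot all_order all_algebra.
From mathcomp Require Import all_classical all_reals all_analysis.
From mathcomp Require Import zify lra.
Import Order.TTheory GRing.Theory Num.Theory.
Import numFieldNormedType.Exports.

Set Implicit Arguments.
Unset Strict Implicit.
Unset Printing Implicit Defensive.

(** * Degrees, neighbourhoods and links *)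

Definition degree (V : finType) (H : {set {set V}}) (v : V) : nat :=
  #|[set e in H | v \in e]%SET|.

(** The closed neighbourhood: it contains [v], except that it is empty when [v] lies on no edge. *)
Definition neighbourhood (V : finType) (H : {set {set V}}) (v : V) : {set V} :=
  finset.cover [set e in H | v \in e]%SET.

Definition edges_meeting (V : finType) (H : {set {set V}}) (Z : {set V}) :
    {set {set V}} :=
  [set e in H | ~~ [disjoint e & Z]]%SET.

Definition half_linked (r : nat) (V : finType) (H : {set {set V}}) (x y : V) :
    bool :=
  (r <= degree (edges_meeting H (neighbourhood H x)) y)%N.

(** The conjunction makes the relation symmetric, which is used when an unlinked set is extended by
    a vertex. *)
Definition linked (r : nat) (V : finType) (H : {set {set V}}) (x y : V) :
    bool :=
  half_linked r H x y && half_linked r H y x.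

Lemma sum_degree_in (V : finType) (H : {set {set V}}) (A : {set V}) :
  (\sum_(v in A) degree H v = \sum_(e in H) #|A :&: e|)%N.
Proof.
under eq_bigr do rewrite /degree -sum1_card.
under [RHS]eq_bigr do rewrite -sum1_card.
rewrite (exchange_big_dep (fun e => e \in H)) /=; last first.
  by move=> v e _; rewrite inE => /andP[].
apply: eq_bigr => e eH; apply: eq_bigl => v.
by rewrite !inE eH.
Qed.

Lemma card_neighbourhood (V : finType) (H : {set {set V}}) (k : nat) (v : V) :
  uniform k H -> (#|neighbourhood H v| <= degree H v * k)%N.
Proof.
move=> uH; apply: leq_trans (leq_card_cover _) _.
rewrite /degree -sum_nat_const leq_sum // => e.
by rewrite inE => /andP[/uH -> _].
Qed.

Lemma degree_edges_meetingS (V : finType) (H : {set {set V}}) (Y Z : {set V})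
    (v : V) :
  Y \subset Z -> (degree (edges_meeting H Y) v <= degree (edges_meeting H Z) v)%N.
Proof.
move=> YZ; apply: subset_leq_card; apply/fintype.subsetP => e.
rewrite !inE -!andbA => /and3P[-> eY ->]; rewrite andbT /=.
by apply: contraNN eY => eZ; rewrite (disjointWr YZ).
Qed.

(** * Linked pairs inside nonedges *)

(** As [phi] is injective, every pair other than {i, j} is sent into [H]. For m outside {i, j}, the
    l - 2 distinct edges [phi [set j; m]] contain y and meet the neighbourhood of x in the vertex
    placed at [f m], which [phi [set i; m]] joins to x. *)
Lemma half_linked_core (l : nat) (V W : finType) (H : {set {set V}})
    (e : {set V}) (f : 'I_l -> W) (g : V -> W)
    (phi : {set 'I_l} -> {set V}) (i j : 'I_l) (x y : V) :
  injective g ->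
  {in edges (complete l) &, injective phi} ->
  (forall p, p \in edges (complete l) -> phi p \in (e |: H)%SET) ->
  (forall p, p \in edges (complete l) -> f @: p \subset g @: phi p) ->
  i != j -> phi [set i; j]%SET = e -> f i = g x -> f j = g y ->
  half_linked (l - 2) H x y.
Proof.
move=> gI phiI phiH fg ij phie fx fy.
have edge2 (a b : 'I_l) : a != b -> [set a; b]%SET \in edges (complete l).
  by move=> ab; rewrite inE cards2 ab.
have mem_phi (a b : 'I_l) z : a != b -> f a = g z -> z \in phi [set a; b]%SET.
  move=> /edge2 /fg /fintype.subsetP /(_ (f a)) sub fz.
  have /sub : f a \in f @: [set a; b]%SET by rewrite imset_f // !inE eqxx.
  by rewrite fz => /imsetP[z' z'phi /gI ->].
have phi_H (a m : 'I_l) : a != m -> m != i -> m != j ->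
    phi [set a; m]%SET \in H.
  move=> am mi mj; have := phiH _ (edge2 _ _ am); rewrite !inE => /orP[|//].
  rewrite -phie => /eqP /(phiI _ _ (edge2 _ _ am) (edge2 _ _ ij)) eqs.
  have : m \in [set a; m]%SET by rewrite !inE eqxx orbT.
  by rewrite eqs !inE (negPf mi) (negPf mj).
pose C := (~: [set i; j])%SET.
have inC m : m \in C -> [/\ j != m, i != m, m != i & m != j].
  by rewrite !inE negb_or => /andP[mi mj]; rewrite mi mj eq_sym mj eq_sym mi.
have cardC : #|C| = (l - 2)%N by rewrite cardsCs finset.setCK card_ord cards2 ij.
have edgeI : {in C &, injective (fun m => phi [set j; m]%SET)}.
  move=> m m' /inC[jm im mi mj] /inC[jm' _ _ _].
  move=> /(phiI _ _ (edge2 _ _ jm) (edge2 _ _ jm')) eqs.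
  have : m \in [set j; m]%SET by rewrite !inE eqxx orbT.
  by rewrite eqs !inE (negPf mj) => /eqP.
rewrite /half_linked /degree -cardC -(card_in_imset edgeI).
apply: subset_leq_card; apply/fintype.subsetP => _ /imsetP[m /inC[jm im mi mj] ->].
rewrite !inE phi_H //= (mem_phi _ _ _ jm fy) andbT.
(* [W] may exceed the image of [g], but [f m] is covered by the edge [phi [set i; m]]. *)
have [z fz] : exists z, f m = g z.
  have /fg /fintype.subsetP /(_ (f m)) := edge2 _ _ im.
  by rewrite imset_f ?inE ?eqxx ?orbT // => /(_ isT) /imsetP[z _ ->]; exists z.
apply/pred0Pn; exists z; rewrite /= finset.setUC mem_phi //=.
apply/bigcupP; exists (phi [set i; m]%SET).
  by rewrite inE phi_H // mem_phi.
by rewrite finset.setUC mem_phi.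
Qed.

Lemma linked_in_nonedge (k l : nat) (V : finType) (H : {set {set V}})
    (e : {set V}) :
  berge_saturated k (complete l) H -> #|e| = k -> e \notin H ->
  exists x y, [/\ x \in e, y \in e, x != y & linked (l - 2) H x y].
Proof.
case=> _ freeH sat_e ek eNH; have [H' H'sub bH'] := sat_e e ek eNH.
have eH' : e \in H'.
  apply: contra_notT freeH => eH'; exists H' => //.
  apply/fintype.subsetP => h hH'; have /fintype.subsetP/(_ h hH') := H'sub.
  by rewrite !inE => /predU1P[he|//]; rewrite -he hH' in eH'.
case: bH' => W [f [g [phi [fI gI phiI phiH' fg]]]].
have phi_in p : p \in edges (complete l) -> phi p \in (e |: H)%SET.
  by move=> pE; apply: (fintype.subsetP H'sub); rewrite -phiH' imset_f.
move: eH'; rewrite -phiH' => /imsetP[p pE ep].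
have p2 : #|p| == 2 by move: pE; rewrite inE.
have [i [j [ij pij]]] := cards2P _ p2.
have /fg := pE; rewrite -ep pij => /fintype.subsetP fsub.
have /imsetP[x xe fx] : f i \in g @: e by rewrite fsub // imset_f // !inE eqxx.
have /imsetP[y ye fy] : f j \in g @: e.
  by rewrite fsub // imset_f // !inE eqxx orbT.
exists x, y; split=> //.
  by apply: contraNneq ij => xy; apply/eqP/fI; rewrite fx fy xy.
have ji : j != i by rewrite eq_sym.
rewrite /linked (half_linked_core gI phiI phi_in fg ij _ fx fy) -?pij //=.
by rewrite (half_linked_core gI phiI phi_in fg ji _ fy fx) // finset.setUC -pij.
Qed.

(** * Unlinked sets and their size *)

Lemma maximal_unlinked (r : nat) (V : finType) (H : {set {set V}})
    (L : {set V}) :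
  exists S : {set V},
    [/\ S \subset L, {in S &, forall x y, x != y -> ~~ linked r H x y}
      & forall y, y \in L -> y \notin S -> exists2 x, x \in S & linked r H x y].
Proof.
pose P (S : {set V}) :=
  (S \subset L) && [forall x in S, forall y in S, (x != y) ==> ~~ linked r H x y].
have P0 : P finset.set0.
  by rewrite /P finset.sub0set; apply/forall_inP => x; rewrite inE.
have [S /maxsetP[/andP[SL /forall_inP SU] maxS] _] := maxset_exists P0.
have SU' : {in S &, forall x y, x != y -> ~~ linked r H x y}.
  by move=> x y /SU /forall_inP Sx /Sx /implyP.
exists S; split=> // y yL yS; apply: contrapT => nlink.
have nl x : x \in S -> ~~ linked r H x y.
  by move=> xS; apply/negP => lxy; apply: nlink; exists x.
suff /maxS /(_ (finset.subsetUr _ _)) eqS : P (y |: S)%SET.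
  by move: yS; rewrite -eqS setU11.
apply/andP; split; first by rewrite finset.subUset finset.sub1set yL.
apply/forall_inP => a; rewrite !inE => aS.
apply/forall_inP => b; rewrite !inE => bS; apply/implyP => ab.
case/predU1P: aS ab => [->|aS]; case/predU1P: bS => [->|bS] ab.
- by rewrite eqxx in ab.
- by rewrite /linked andbC nl.
- exact: nl.
- exact: SU'.
Qed.

Lemma exists_subset_between (V : finType) (A B : {set V}) (k : nat) :
  A \subset B -> (#|A| <= k <= #|B|)%N ->
  exists2 E : {set V}, A \subset E & E \subset B /\ #|E| = k.
Proof.
move=> AB /andP[Ak kB].
(* The sets that can be added to [A] are counted by a binomial coefficient, positive by the size
   bounds. *)
have : (0 < #|[set E : {set V} | E \subset B :\: A & #|E| == k - #|A|]%SET|)%N.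
  by rewrite cards_draws bin_gt0 cardsDS // leq_sub2r.
case/card_gt0P => E; rewrite inE => /andP[EBA /eqP cE].
exists (A :|: E)%SET; first exact: finset.subsetUl.
split; first by rewrite finset.subUset AB (fintype.subset_trans EBA) // finset.subsetDl.
move: EBA; rewrite finset.subsetD => /andP[_ disjEA].
by rewrite cardsU finset.setIC (disjoint_setI0 disjEA) cards0 subn0 cE subnKC.
Qed.

(** If S has more than k vertices, fix x in S: any y in S lies with x in a k-subset of S, which is
    an edge because a nonedge contains a linked pair. So S lies in the neighbourhood of x, of size
    at most D * k. *)
Lemma card_unlinked (k l D : nat) (V : finType) (H : {set {set V}})
    (S : {set V}) :
  (2 <= k)%N -> berge_saturated k (complete l) H ->
  {in S, forall x, degree H x <= D}%N ->
  {in S &, forall x y, x != y -> ~~ linked (l - 2) H x y} ->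
  (#|S| <= k + D * k)%N.
Proof.
move=> k2 satH SD SU; have [uH _ _] := satH.
case: (leqP #|S| k) => [|kS]; first lia.
have [x xS] : exists x, x \in S by apply/card_gt0P; lia.
apply: leq_trans (leq_addl _ _).
apply: (@leq_trans #|neighbourhood H x|); last first.
  by rewrite (leq_trans (card_neighbourhood x uH)) // leq_mul2r SD // orbT.
apply: subset_leq_card; apply/fintype.subsetP => y yS.
have [||e exy [eS ek]] := @exists_subset_between _ [set x; y]%SET S k.
- by rewrite finset.subUset !finset.sub1set xS yS.
- by rewrite cards2 (ltnW kS) andbT (leq_trans _ k2) // ltnS leq_b1.
have eH : e \in H.
  apply: contraT => eH.
  have [a [b [ae be ab lab]]] := linked_in_nonedge satH ek eH.
  by rewrite (negPf (SU _ _ _ _ ab)) ?(fintype.subsetP eS) in lab.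
apply/bigcupP; exists e; last by rewrite (fintype.subsetP exy) // !inE eqxx orbT.
by rewrite inE eH (fintype.subsetP exy) // !inE eqxx.
Qed.

(** * Counting the edges that meet a bounded set *)

(** The bound is multiplied by D + 1 to stay in the natural numbers. The constant comes from at most
    k + D * k closed neighbourhoods of size at most D * k + 1. *)
Lemma saturated_count (k l D : nat) (V : finType) (H : {set {set V}}) :
  (2 <= k)%N -> berge_saturated k (complete l) H ->
  ((l - 2) * D.+1 * #|V| <= ((k - 1) * D.+1 + (l - 2) * k) * #|H|
     + (l - 2) * D.+1 * ((k + D * k) * (D * k).+1))%N.
Proof.
move=> k2 satH; have [uH _ _] := satH.
pose L : {set V} := [set v | (degree H v <= D)%N]%SET.
have [S [SL SU maxS]] := maximal_unlinked (l - 2) H L.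
have SD : {in S, forall x, degree H x <= D}%N.
  by move=> x /(fintype.subsetP SL); rewrite inE.
(* Adding x itself puts isolated vertices of S into Z, so that maximality of S applies to every
   vertex of L outside Z. *)
pose Z : {set V} := (\bigcup_(x in S) (x |: neighbourhood H x))%SET.
have NZ x : x \in S -> neighbourhood H x \subset Z.
  by move=> xS; apply: (bigcup_max x xS); rewrite finset.subsetUr.
have cZ : (#|Z| <= (k + D * k) * (D * k).+1)%N.
  apply: (@leq_trans (#|S| * (D * k).+1)); last first.
    by rewrite leq_mul2r (card_unlinked k2 satH SD SU) orbT.
  rewrite -sum_nat_const; apply: (@leq_trans (\sum_(x in S) #|(x |: neighbourhood H x)%SET|)).
    elim/big_ind2: (Z) => [|A a B b Aa Bb|//]; first by rewrite cards0.
    by rewrite (leq_trans _ (leq_add Aa Bb)) // cardsU leq_subr.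
  apply: leq_sum => x xS; rewrite cardsU1 (leq_add (leq_b1 _)) //.
  by rewrite (leq_trans (card_neighbourhood x uH)) // leq_mul2r SD ?orbT.
pose A := (L :\: Z)%SET.
have lowA : ((l - 2) * #|A| <= (k - 1) * #|H|)%N.
  (* Each v in A lies in at least l - 2 edges that meet Z, and each such edge has a vertex in Z,
     hence at most k - 1 in A. *)
  apply: (@leq_trans (\sum_(v in A) degree (edges_meeting H Z) v)).
    rewrite mulnC -sum_nat_const; apply: leq_sum => y; rewrite inE => /andP[yZ yL].
    have yS : y \notin S.
      by apply: contra yZ => yS; apply/bigcupP; exists y; rewrite // !inE eqxx.
    have [x xS /andP[lxy _]] := maxS y yL yS.
    exact: leq_trans lxy (degree_edges_meetingS H _ (NZ x xS)).
  rewrite sum_degree_in; apply: (@leq_trans (\sum_(e in edges_meeting H Z) (k - 1))).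
    apply: leq_sum => e; rewrite inE => /andP[/uH <-] /pred0Pn[z /= /andP[ze zZ]].
    rewrite (cardsD1 z e) ze add1n subn1 /=; apply: subset_leq_card.
    apply/fintype.subsetP => v; rewrite !inE => /andP[/andP[vZ _] ->]; rewrite andbT.
    by apply: contraNneq vZ => ->.
  rewrite sum_nat_const mulnC leq_mul2l subset_leq_card ?orbT //.
  by apply/fintype.subsetP => e; rewrite inE => /andP[].
have highL : (#|~: L| * D.+1 <= #|H| * k)%N.
  apply: (@leq_trans (\sum_(v in (~: L)%SET) degree H v)).
    rewrite -sum_nat_const; apply: leq_sum => v; by rewrite !inE -ltnNge.
  rewrite sum_degree_in -sum_nat_const; apply: leq_sum => e /uH <-.
  exact/subset_leq_card/finset.subsetIr.
have cV : (#|V| <= #|A| + #|Z| + #|~: L|)%N.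
  rewrite -(cardsC L) leq_add2r -(cardsID Z L) addnC leq_add2l.
  exact/subset_leq_card/finset.subsetIr.
move: (#|V|) (#|A|) (#|Z|) (#|~: L|) (#|H|) (k - 1)%N (l - 2)%N (_ * (D * k).+1)%N
  lowA highL cV cZ => v a z w m b r C lowA highL cV cZ.
apply: (@leq_trans (r * D.+1 * (a + z + w))); first by rewrite leq_mul2l cV orbT.
have := leq_mul (leqnn D.+1) lowA; have := leq_mul (leqnn r) highL.
have := leq_mul (leqnn (r * D.+1)) cZ.
nia.
Qed.

(** * Passage to the limit *)

Local Open Scope classical_set_scope.
Local Open Scope ring_scope.

Lemma sat_asymptotic_lower_bound (R : realType) (k l : nat) (e : R) :
  (2 <= k)%N -> (3 <= l)%N -> 0 < e ->
  \forall n \near \oo,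
    (1 - e) * ((l%:R - 2) / (k%:R - 1) * n%:R) <= (sat k n (complete l))%:R.
Proof.
move=> k2 l3 e0.
pose r : R := l%:R - 2; pose b : R := k%:R - 1.
have rE : (l - 2)%:R = r by rewrite natrB 1?ltnW.
have bE : (k - 1)%:R = b by rewrite natrB 1?ltnW.
have r1 : 1 <= r by rewrite -rE ler1n; lia.
have b1 : 1 <= b by rewrite -bE ler1n; lia.
(* Once |H| <= r n is known, this makes the error r k |H| at most half of e (D + 1) r n; [nC] does
   the same for the error coming from [C]. *)
have [D De] : exists D : nat, 2 * r * k%:R / e <= D.+1%:R.
  exists (Num.truncn (2 * r * k%:R / e)).
  exact/ltW/truncnS_gt.
pose C : R := ((k + D * k) * (D * k).+1)%:R.
near=> n.
have nC : 2 * C / e <= n%:R by near: n; exact: nbhs_infty_ger.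
(* An edge guarantees a saturated hypergraph, so [sat] is attained and is not its default value. *)
have edge_l : edges (complete l) != finset.set0.
  apply/set0Pn; exists [set Ordinal (ltnW (ltnW l3)); Ordinal (ltnW l3)]%SET.
  by rewrite inE cards2.
have [H satH <-] := sat_attained (berge_saturated_exists k 'I_n edge_l).
have := saturated_count D k2 satH; rewrite card_ord -(ler_nat R).
rewrite !(natrD, natrM) rE bE -!natrM -natrD -!natrM -/C.
move: (#|H|%:R : R) (ler0n R #|H|) (D.+1%:R : R) (ltr0Sn R D) De => m m0 d d0 De count.
(* Arguing by contradiction supplies the a priori bound [m_le], needed to control the error r k
   m. *)
rewrite leNgt; apply/negP => small.
have {}small : b * m < (1 - e) * (r * n%:R).
  by move: small; rewrite mulrAC mulrA ltr_pdivlMr ?(lt_le_trans ltr01) // mulrC.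
have rn0 : 0 <= r * n%:R by rewrite mulr_ge0 // (le_trans ler01).
have m_le : m <= r * n%:R.
  apply: (@le_trans _ _ (b * m)); first by rewrite ler_peMl.
  by rewrite (le_trans (ltW small)) // ler_piMl // lerBlDr lerDl ltW.
rewrite ler_pdivrMr // in De; rewrite ler_pdivrMr // in nC.
have : d * (b * m) < d * ((1 - e) * (r * n%:R)) by rewrite ltr_pM2l.
have : 2 * r * k%:R * m <= d * e * (r * n%:R).
  rewrite ler_pM // !mulr_ge0 // (le_trans ler01) //.
have : r * d * (2 * C) <= r * d * (n%:R * e).
  by rewrite ler_wpM2l // mulr_ge0 ?(ltW d0) // (le_trans ler01).
move: count; lra.
Unshelve. all: by end_near.
Qed.

Theorem theorem2p1 (R : realType) (k l : nat) (hk : (2 <= k)%N)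
    (hl : (3 <= l)%N) :
  exists2 o1 : nat -> R, o1 n @[n --> \oo] --> (0 : R) &
    \forall n \near \oo,
      (1 + o1 n) * ((l%:R - 2) / (k%:R - 1)) * n%:R
        <= (sat k n (complete l))%:R.
Proof.
pose c : R := (l%:R - 2) / (k%:R - 1).
have c0 : 0 < c by rewrite divr_gt0 // subr_gt0 ?ltr1n ?ltr_nat.
(* The relative excess of [sat] over c n satisfies the inequality by construction for n > 0. Capping
   it at 0 makes the lower bound alone enough for convergence. *)
pose o1 (n : nat) : R := Num.min 0 ((sat k n (complete l))%:R / (c * n%:R) - 1).
exists o1; last first.
  near=> n.
  have n0 : 0 < n%:R :> R by rewrite ltr0n; near: n; exact: nbhs_infty_gt.
  have cn0 : 0 < c * n%:R by rewrite mulr_gt0.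
  by rewrite -mulrA -ler_pdivlMr // -lerBrDl /o1 ge_min lexx orbT.
apply/cvgrPdist_le => e e0; near=> n.
have n0 : 0 < n%:R :> R by rewrite ltr0n; near: n; exact: nbhs_infty_gt.
have cn0 : 0 < c * n%:R by rewrite mulr_gt0.
rewrite sub0r normrN ler0_norm ?ge_min ?lexx // lerNl le_min oppr_le0 ltW //=.
rewrite lerBrDl ler_pdivlMr //.
by near: n; exact: sat_asymptotic_lower_bound.
Unshelve. all: by end_near.
Qed.
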